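(* For $i=1,\ldots,6$ let $M_i$ and $v_i$ be the following matrices and vectors: $$M_1=\begin{pmatrix} 4 & 2\\ 6x & 0\end{pmatrix},\ v_1=\begin{pmatrix} 1\\ x\end{pmatrix};\qquad M_2=\begin{pmatrix} 0 & 4\\ 2x & 2\end{pmatrix},\ v_2=\begin{pmatrix} 1\\ 1\end{pmatrix};$$ $$M_3=6\begin{pmatrix} 3x & 3\\ 2x & 1+3x\end{pmatrix},\ v_3=2\begin{pmatrix} 2\\ 1+x\end{pmatrix};\qquad M_4=4\begin{pmatrix} 2+3x & 1\\ 4x & 2x\end{pmatrix},\ v_4=2\begin{pmatrix} 1+x\\ 2x\end{pmatrix};$$ $$M_5=\begin{pmatrix} 192x & 96+288x\\ 72x+192x^2 & 24+288x\end{pmatrix},\ v_5=\begin{pmatrix} 18+18x\\ 6+30x\end{pmatrix};$$ $$M_6=\begin{pmatrix} 8+68x & 4+16x\\ 32x+48x^2 & 16x\end{pmatrix},\ v_6=\begin{pmatrix} 2+14x\\ 8x+8x^2\end{pmatrix}.$$ Then for every $i\in\{1,\ldots,6\}$ and every integer $k\ge 1$, all zeros of the first entry of the vector $M_i^k v_i$ (a genus polynomial of a graph in the $i$-th linear family) are real and negative.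
   Context: The genus polynomial of a finite graph $G$ is $\sum_{k\ge0}\gamma(G,k)x^k$, where $\gamma(G,k)$ is the number of distinct embeddings of $G$ into an oriented surface of genus $k$. For an $H$-linear family of graphs $\{G_n\}$ (obtained by consistently amalgamating additional copies of a graph $H$), Stahl showed that there are a square matrix $M$ and a vector $v$ with entries in $\mathbb{Z}[x]$ such that the genus polynomial of $G_n$ is the first entry of $M^n v$. The pairs $(M_i,v_i)$ are Stahl's generating matrices and initial vectors for: cobblestone paths ($i=1$), ladders ($i=2$), double ladders ($i=3$), diamonds ($i=4$), triple ladders ($i=5$), $K_4$-linear graphs ($i=6$). Thus the genus polynomials of these graphs are, for the purposes of the claim, the first entries of $M_i^k v_i$. *)

(* Defs.v *)
From mathcomp Require Import all_boot all_order all_algebra.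
From mathcomp Require Import reals complex.

Set Implicit Arguments.
Unset Strict Implicit.
Unset Printing Implicit Defensive.

Import Order.TTheory GRing.Theory Num.Theory.
Local Open Scope ring_scope.

Definition mx2 (T : Type) (a b c d : T) : 'M[T]_2 :=
  \matrix_(i < 2, j < 2)
    if i == 0 then (if j == 0 then a else b) else (if j == 0 then c else d).

Definition cv2 (T : Type) (a b : T) : 'cV[T]_2 :=
  \col_(i < 2) if i == 0 then a else b.

(* Stahl's generating matrices and initial vectors for, in order: cobblestone
   paths, ladders, double ladders, diamonds, triple ladders and K4-linear
   graphs. Only the indices 1 to 6 are meaningful. *)
Definition stahl_mx (i : nat) : 'M[{poly int}]_2 :=
  match i with
  | 1%N => mx2 4 2
               (6 * 'X) 0
  | 2%N => mx2 0 4
               (2 * 'X) 2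
  | 3%N => 6 *: mx2 (3 * 'X) 3
                    (2 * 'X) (1 + 3 * 'X)
  | 4%N => 4 *: mx2 (2 + 3 * 'X) 1
                    (4 * 'X) (2 * 'X)
  | 5%N => mx2 (192 * 'X) (96 + 288 * 'X)
               (72 * 'X + 192 * 'X^2) (24 + 288 * 'X)
  | 6%N => mx2 (8 + 68 * 'X) (4 + 16 * 'X)
               (32 * 'X + 48 * 'X^2) (16 * 'X)
  | _ => 0
  end.

Definition stahl_vec (i : nat) : 'cV[{poly int}]_2 :=
  match i with
  | 1%N => cv2 1 'X
  | 2%N => cv2 1 1
  | 3%N => 2 *: cv2 2 (1 + 'X)
  | 4%N => 2 *: cv2 (1 + 'X) (2 * 'X)
  | 5%N => cv2 (18 + 18 * 'X) (6 + 30 * 'X)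
  | 6%N => cv2 (2 + 14 * 'X) (8 * 'X + 8 * 'X^2)
  | _ => 0
  end.

Definition stahl_poly (i k : nat) : {poly int} :=
  (stahl_mx i ^+ k *m stahl_vec i) 0 0.

(* Main.v *)
Require Import Defs.
From mathcomp Require Import all_boot all_order all_algebra.
From mathcomp Require Import reals complex.
From mathcomp Require Import separable ring zify.
Import Order.TTheory GRing.Theory Num.Theory.
Local Open Scope ring_scope.

(** Write M = (a b; c d) and M^k v = (p_k, q_k), so that
    p_{k+2} = tr M p_{k+1} - det M p_k, with det M > 0 on the negative axis.
    Put F = b p_k and G = p_{k+1}; then deg G <= deg F + 1 and all coefficients
    are nonnegative.  The invariant is that F has only negative roots s, with
    G(s) F'(s) < 0 at each of them.  Expanding in partial fractions,
    G/F = alpha x + beta + sum_s c_s / (x - s) with alpha >= 0 and c_s < 0, so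
    Im (G/F) has the sign of Im x: all roots of G are real, hence negative.
    Moreover G/F is increasing, so G' F > 0 at the roots of G; with the
    recurrence and det M > 0 this is the invariant for b p_{k+1} and p_{k+2} at
    the roots of p_{k+1}.  At the root of b, p_{k+2} = a p_{k+1} with a < 0. *)

(** * Partial fractions at simple roots *)

(** The difference of the two sides vanishes at every point of [rs], because F / (X - s) takes the
    value F'(s) at s and 0 at the other roots. The [X * F] term cancels the coefficient of degree
    [size F], and [beta] the one of degree [size rs]. What remains has more roots than its degree
    allows, so it is zero. *)
Lemma partial_fractions (K : fieldType) (F G : {poly K}) (rs : seq K) :
    F = lead_coef F *: \prod_(s <- rs) ('X - s%:P) -> F != 0 -> uniq rs ->
    (size G <= (size F).+1)%N ->
  exists beta : K,
    G = (G`_(size F) / lead_coef F) *: ('X * F) + beta *: F +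
        \sum_(s <- rs) (G.[s] / F^`().[s]) *: (F %/ ('X - s%:P)).
Proof.
move=> F_rs F0 rs_uniq sG; set alpha := G`_(size F) / lead_coef F.
have lF0 : lead_coef F != 0 by rewrite lead_coef_eq0.
have sF : size F = (size rs).+1.
  by rewrite F_rs size_scale // size_prod_XsubC.
have rootF s : root F s = (s \in rs).
  by rewrite {1}F_rs rootZ // root_prod_XsubC.
have FQ s : s \in rs -> F = (F %/ ('X - s%:P)) * ('X - s%:P).
  by rewrite -rootF => rFs; rewrite divpK // -root_factor_theorem // -dvdp_XsubCl.
have sQ s : s \in rs -> size (F %/ ('X - s%:P)) = size rs.
  by move=> _; rewrite size_divp ?polyXsubC_eq0 // size_XsubC sF /= subn1.
have sepF : coprimep F F^`().
  rewrite F_rs derivZ coprimepZl // coprimepZr //.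
  by have := separable_prod_XsubC rs; rewrite separable_poly.unlock rs_uniq.
have dF0 s : s \in rs -> F^`().[s] != 0.
  by rewrite -rootF; apply: coprimep_root.
have Qs s : s \in rs -> (F %/ ('X - s%:P)).[s] = F^`().[s].
  move=> /FQ {2}->; rewrite derivM derivXsubC !hornerE.
  by rewrite subrr mulr0 add0r.
have Qt s t : s \in rs -> t \in rs -> t != s -> (F %/ ('X - s%:P)).[t] = 0.
  move=> srs trs ts; have /eqP : F.[t] = 0 by apply/rootP; rewrite rootF.
  rewrite {1}(FQ s srs) !hornerE mulf_eq0 subr_eq0 (negPf ts) orbF.
  by move/eqP.
pose beta := (G - alpha *: ('X * F))`_(size rs) / lead_coef F.
exists beta.
set S := (\sum_(_ <- _) _); apply/eqP; rewrite -subr_eq0.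
apply: contraT => H0.
have := max_poly_roots H0 (rs := rs); rewrite rs_uniq.
have -> : all (root (G - (alpha *: ('X * F) + beta *: F + S))) rs.
  apply/allP => t trs; apply/rootP.
  have Ft : F.[t] = 0 by apply/rootP; rewrite rootF.
  rewrite !hornerE Ft !(mulr0, add0r) /S horner_sum (bigD1_seq t) //=.
  rewrite hornerZ Qs // divfK ?dF0 // big1_seq ?addr0 ?mulr0 ?add0r ?subrr // => s /andP[st srs].
  by rewrite hornerZ Qt ?mulr0 // eq_sym.
move=> /(_ isT isT) sH.
suff : (size (G - (alpha *: ('X * F) + beta *: F + S))%R <= size rs)%N.
  by rewrite leqNgt sH.
rewrite opprD addrA (leq_trans (size_polyD _ _)) // geq_max size_polyN.
apply/andP; split; last first.
  rewrite /S big_seq; apply: (big_ind (fun p : {poly K} => (size p <= size rs)%N)).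
  - by rewrite size_poly0.
  - by move=> p q hp hq; rewrite (leq_trans (size_polyD _ _)) // geq_max hp.
  - by move=> s srs; rewrite (leq_trans (size_scale_leq _ _)) ?sQ.
rewrite opprD addrA; apply/leq_sizeP => j.
have FE : F`_(size rs) = lead_coef F by rewrite lead_coefE sF.
rewrite leq_eqVlt => /predU1P[<-|jlt].
  by rewrite coefB [(beta *: F)`_ _]coefZ FE /beta divfK // subrr.
rewrite !coefB !coefZ coefXM [F`_j]nth_default ?sF // mulr0 subr0.
case: j jlt => // j; rewrite ltnS leq_eqVlt => /predU1P[<-|jlt] /=.
  by rewrite FE /alpha sF divfK // subrr.
rewrite [F`_j]nth_default ?sF // nth_default ?mulr0 ?subrr //.
by rewrite (leq_trans sG) // sF.
Qed.

Lemma real_horner_conj (C : numClosedFieldType) (p : {poly C}) (z : C) :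
  p \is a polyOver Num.real -> p.[z^*] = (p.[z])^*.
Proof.
move=> /polyOverP pR; rewrite !horner_coef rmorph_sum; apply: eq_bigr => i _.
by rewrite rmorphM rmorphXn /= (CrealP (pR i)).
Qed.

(** * Real roots from a sign condition *)

(** The argument on Im (G/F) is carried out free of denominators: with u the conjugate of t, G(t)
    F(u) - G(u) F(t) = (t - u) E, where every term of E is nonnegative. The confluent case u = t
    reads G' F - G F' = E and yields the second conclusion. *)
Lemma root_real_of_alternation (C : numClosedFieldType) (F G : {poly C}) :
    F \is a polyOver Num.real -> G \is a polyOver Num.real ->
    F != 0 -> G != 0 -> (size G <= (size F).+1)%N ->
    0 <= G`_(size F) / lead_coef F ->
    (forall s, root F s -> s \is Num.real /\ G.[s] * F^`().[s] < 0) ->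
  forall t, root G t -> t \is Num.real /\ 0 < G^`().[t] * F.[t].
Proof.
move=> FR GR F0 G0 sG alpha_ge0 FG t /rootP Gt.
have [rs F_rs] := closed_field_poly_normal F.
have lF0 : lead_coef F != 0 by rewrite lead_coef_eq0.
have rootF s : root F s = (s \in rs).
  by rewrite {1}F_rs rootZ // root_prod_XsubC.
(* A multiple root s would give F'(s) = 0, against G(s) F'(s) < 0. *)
have rs_uniq : uniq rs.
  rewrite -separable_prod_XsubC separable_poly.unlock.
  have : coprimep F F^`().
    apply: Pdiv.ClosedField.root_coprimep => s /FG[_].
    by apply: contraTneq => ->; rewrite mulr0 ltxx.
  by rewrite {1 2}F_rs derivZ coprimepZl // coprimepZr.
have [beta GE] := partial_fractions _ _ _ _ F_rs F0 rs_uniq sG.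
move: (G`_(size F) / lead_coef F) alpha_ge0 GE => alpha alpha_ge0 GE.
pose c s := G.[s] / F^`().[s].
pose Q s := F %/ ('X - s%:P).
have c_lt0 s : s \in rs -> c s < 0.
  rewrite -rootF => /FG[sR GFs].
  have dFs0 : F^`().[s] != 0 by apply: contraTneq GFs => ->; rewrite mulr0 ltxx.
  have -> : c s = G.[s] * F^`().[s] * (F^`().[s])^-1 ^+ 2.
    by rewrite /c; field.
  rewrite pmulr_llt0 // real_exprn_even_gt0 ?invr_eq0 ?dFs0 ?orbT //.
  rewrite rpredV; apply: rpred_horner => //.
  by apply/polyOverP => j; rewrite coef_deriv rpredMn //; apply/polyOverP.
have FQ s : s \in rs -> F = ('X - s%:P) * Q s.
  by rewrite -rootF => rFs; rewrite mulrC divpK // dvdp_XsubCl.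
have Ft0 : F.[t] != 0.
  apply/negP => /FG[_]; by rewrite Gt mul0r ltxx.
have Fz s z : s \in rs -> F.[z] = (z - s) * (Q s).[z].
  by move=> /FQ {1}->; rewrite hornerM hornerXsubC.
have dFz s z : s \in rs -> F^`().[z] = (Q s).[z] + (z - s) * (Q s)^`().[z].
  move=> /FQ {1}->.
  by rewrite derivM derivXsubC hornerD !hornerM hornerXsubC hornerC mul1r.
have tC s : s \in rs -> (t - s != 0) /\ s^* = s.
  rewrite -rootF => rs_s; split; last by have [/CrealP] := FG s rs_s.
  by rewrite subr_eq0; apply: contraNneq Ft0 => ->.
pose E := alpha * `|F.[t]| ^+ 2 - \sum_(s <- rs) c s * `|(Q s).[t]| ^+ 2.
have E_gt0 : 0 < E.
  have sum_ge0 : 0 <= - \sum_(s <- rs) c s * `|(Q s).[t]| ^+ 2.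
    rewrite -sumrN big_seq sumr_ge0 // => s srs.
    by rewrite -mulNr mulr_ge0 ?exprn_ge0 // oppr_ge0 ltW ?c_lt0.
  have Ft_gt0 : 0 < `|F.[t]| ^+ 2 by rewrite exprn_gt0 // normr_gt0.
  move: alpha_ge0; rewrite {}/E le0r => /predU1P[alpha0|alpha_gt0]; last first.
    by rewrite ltr_wpDr // mulr_gt0.
  (* With [alpha] zero, F must have a root: otherwise G = [beta] F, and G(t) = 0 with F(t) nonzero
     forces G = 0. One root suffices, since Q_s(t) is nonzero when F(t) is. *)
  case: rs {F_rs rs_uniq dFz rootF FQ tC} GE c_lt0 Fz sum_ge0 => [|s rs] GE c_lt0 Fz sum_ge0.
    case/negP: G0.
    move: Gt; rewrite GE alpha0 scale0r big_nil addr0 add0r hornerZ.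
    by move/eqP; rewrite mulf_eq0 (negPf Ft0) orbF => /eqP ->; rewrite scale0r.
  rewrite alpha0 mul0r add0r big_cons opprD ltr_pwDl //.
    rewrite -mulNr mulr_gt0 ?oppr_gt0 ?c_lt0 ?mem_head // exprn_gt0 // normr_gt0.
    by apply: contraNneq Ft0 => Qt; rewrite (Fz s) ?mem_head // Qt mulr0.
  rewrite -sumrN big_seq sumr_ge0 // => u urs.
  by rewrite -mulNr mulr_ge0 ?exprn_ge0 // oppr_ge0 ltW ?c_lt0 // inE urs orbT.
(* Compatibility of Q_s with conjugation is inherited from F by cancelling the factor X - s, as s is
   real. *)
have QC s : s \in rs -> (Q s).[t^*] = ((Q s).[t])^*.
  move=> srs; have [ts sC] := tC s srs.
  have tsC : t^* - s != 0 by rewrite -sC -rmorphB fmorph_eq0.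
  apply: (mulfI tsC).
  by rewrite -Fz // (real_horner_conj _ _ t FR) (Fz s) // rmorphM rmorphB /= sC.
have [P PE] : {P | P = \sum_(s <- rs) c s *: Q s} by eexists.
rewrite -[X in _ + X]/(\sum_(s <- rs) c s *: Q s) -PE in GE.
have Gz z : G.[z] = (alpha * z + beta) * F.[z] + \sum_(s <- rs) c s * (Q s).[z].
  have -> : \sum_(s <- rs) c s * (Q s).[z] = P.[z].
    by rewrite PE horner_sum; apply: eq_bigr => s _; rewrite hornerZ.
  rewrite {1}GE !(hornerD, hornerZ, hornerM, hornerX); ring.
have dGz z : G^`().[z] = alpha * (F.[z] + z * F^`().[z]) + beta * F^`().[z] +
                         \sum_(s <- rs) c s * (Q s)^`().[z].
  have -> : \sum_(s <- rs) c s * (Q s)^`().[z] = P^`().[z].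
    rewrite PE raddf_sum horner_sum; apply: eq_bigr => s _.
    by rewrite /= derivZ hornerZ.
  rewrite {1}GE !(derivD, derivZ, derivM, derivX).
  rewrite !(hornerD, hornerZ, hornerM, hornerX, hornerC); ring.
(* As G has real coefficients, it also vanishes at t^*, so t = t^* since E > 0. *)
have bezout : G.[t] * F.[t^*] - G.[t^*] * F.[t] = (t - t^*) * E.
  rewrite !Gz /E mulrBr normCK -(real_horner_conj _ _ t FR).
  have -> : (t - t^*) * \sum_(s <- rs) c s * `|(Q s).[t]| ^+ 2 =
      F.[t] * (\sum_(s <- rs) c s * (Q s).[t^*]) -
      F.[t^*] * (\sum_(s <- rs) c s * (Q s).[t]).
    rewrite !mulr_sumr -sumrB; apply: eq_big_seq => s srs.
    rewrite normCK -QC // !(Fz s) //; ring.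
  ring.
have tR : t^* = t.
  have : G.[t^*] = 0 by rewrite real_horner_conj // Gt conjC0.
  move=> Gtc; move: bezout; rewrite Gt Gtc !mul0r subrr => /esym/eqP.
  by rewrite mulf_eq0 (gt_eqF E_gt0) orbF subr_eq0 => /eqP.
split; first by apply/CrealP.
suff -> : G^`().[t] * F.[t] = E by [].
(* Since G(t) = 0, the left side may be completed to the Wronskian G' F - G F'; t being real,
   |Q_s(t)|^2 is Q_s(t)^2. *)
rewrite -[LHS]subr0 -[X in _ - X](mul0r F^`().[t]) -{1}Gt dGz Gz /E.
rewrite normCK -(real_horner_conj _ _ t FR) tR.
have -> : \sum_(s <- rs) c s * `|(Q s).[t]| ^+ 2 =
    F^`().[t] * (\sum_(s <- rs) c s * (Q s).[t]) -
    F.[t] * (\sum_(s <- rs) c s * (Q s)^`().[t]).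
  rewrite !mulr_sumr -sumrB; apply: eq_big_seq => s srs.
  rewrite normCK -QC // tR (Fz s) // (dFz s) //; ring.
ring.
Qed.

(** * Polynomials with nonnegative coefficients *)

Lemma nneg_poly_real (C : numDomainType) (p : {poly C}) :
  p \is a polyOver Num.nneg -> p \is a polyOver Num.real.
Proof. by move/polyOverP=> pN; apply/polyOverP => i; rewrite ger0_real // -nnegrE. Qed.

(** Nonnegative coefficients cannot cancel. *)
Lemma size_nneg_addl (C : numDomainType) (p q : {poly C}) :
    p \is a polyOver Num.nneg -> q \is a polyOver Num.nneg ->
  (size p <= size (p + q)%R)%N.
Proof.
move=> /polyOverP pN /polyOverP qN; apply/leq_sizeP => j hj; apply/eqP.
have /eqP := nth_default 0 hj; rewrite coefD paddr_eq0 -?nnegrE //.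
by case/andP.
Qed.

Lemma nneg_horner_gt0 (C : numDomainType) (p : {poly C}) (x : C) :
  p \is a polyOver Num.nneg -> 0 < p.[0] -> 0 <= x -> 0 < p.[x].
Proof.
move=> /polyOverP pN p0 x0; have sp : (0 < size p)%N.
  by rewrite lt0n size_poly_eq0; apply: contraTneq p0 => ->; rewrite horner0 ltxx.
rewrite horner_coef -(prednK sp) big_ord_recl expr0 mulr1 ltr_pwDl -?horner_coef0 //.
by apply: sumr_ge0 => i _; rewrite mulr_ge0 ?exprn_ge0 // -nnegrE.
Qed.

(** * Induction along a two-by-two transfer matrix *)

(** The factor b in F = b p_k makes up for the degree that b may contribute to p_{k+1}. The
    conditions at the roots of b and of p_0 supply the sign invariant at k = 0; the determinant
    condition carries it from k to k + 1. *)
Lemma transfer_roots_lt0 (C : numClosedFieldType) (a b c d : {poly C})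
    (p q : nat -> {poly C}) :
    (forall k, p k.+1 = a * p k + b * q k) ->
    (forall k, q k.+1 = c * p k + d * q k) ->
    b \is a polyOver Num.nneg -> (forall k, p k \is a polyOver Num.nneg) ->
    b != 0 -> (forall k, 0 < (p k).[0]) ->
    (forall k, (size (p k.+1) <= size b + size (p k))%N) ->
    (forall x, x < 0 -> 0 < (a * d - b * c).[x]) ->
    (forall x, root b x ->
       [/\ x < 0, a.[x] < 0, 0 < b^`().[x] & (p 0).[x] != 0]) ->
    (forall x, root (p 0) x -> x < 0 /\ (p 0)^`().[x] * (q 0).[x] < 0) ->
  forall k x, root (p k) x -> x < 0.
Proof.
move=> pS qS bN pN b0 p_gt0 sp D_gt0 b_root p0_root k.
have bR := nneg_poly_real _ _ bN; have pR j := nneg_poly_real _ _ (pN j).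
have realP f x : f \is a polyOver Num.real -> x < 0 -> f.[x] \is Num.real.
  by move=> fR x0; apply: rpred_horner => //; apply: ltr0_real.
have sqr_gt0 f x : f \is a polyOver Num.real -> x < 0 -> f.[x] != 0 ->
    0 < f.[x] ^+ 2.
  by move=> fR x0 fx; rewrite real_exprn_even_gt0 ?fx ?realP.
have pN0 j : p j != 0.
  by apply: contraTneq (p_gt0 j) => ->; rewrite horner0 ltxx.
suff [] : (forall x, root (p k) x -> x < 0) /\
  (forall x, root (b * p k) x -> x < 0 /\ (p k.+1).[x] * (b * p k)^`().[x] < 0) by [].
elim: k => [|k [IHx IH]].
  split=> [x /p0_root[]//|x]; rewrite rootM => /orP[bx|px].
    have [x0 ax b'x p0x] := b_root x bx; split=> //.
    (* At a root of b both factors simplify: p_1 = a p_0 and (b p_0)' = b' p_0. At a root of p_0,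
       treated next, they are b q_0 and b p_0'. *)
    have -> : (p 1).[x] * (b * p 0)^`().[x] = a.[x] * (b^`().[x] * (p 0).[x] ^+ 2).
      rewrite pS derivM !hornerD !hornerM (rootP bx); ring.
    by rewrite nmulr_rlt0 // mulr_gt0 // sqr_gt0.
  have [x0 pqx] := p0_root x px; split=> //.
  have bx : b.[x] != 0.
    apply/negP => bx; have [_ _ _] := b_root x bx.
    by rewrite (rootP px) eqxx.
  have -> : (p 1).[x] * (b * p 0)^`().[x] = (p 0)^`().[x] * (q 0).[x] * b.[x] ^+ 2.
    rewrite pS derivM !hornerD !hornerM (rootP px); ring.
  by rewrite pmulr_llt0 // sqr_gt0.
have p_root : forall x, root (p k.+1) x ->
    x < 0 /\ 0 < (p k.+1)^`().[x] * (b * p k).[x].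
  move=> x px.
  have [] := root_real_of_alternation _ (b * p k) (p k.+1) _ _ _ _ _ _ _ x px => //.
  - by apply: polyOver_mulr_2closed.
  - by rewrite mulf_neq0.
  - by rewrite size_mul // prednK // addn_gt0 !lt0n !size_poly_eq0 b0.
  - apply: divr_ge0; first by rewrite -nnegrE; apply/polyOverP.
    rewrite -nnegrE lead_coefE; apply/polyOverP; exact: polyOver_mulr_2closed.
  - by move=> s /IH[s0 hs]; split=> //; apply: ltr0_real.
  (* A real root cannot be nonnegative: there p_{k+1} is at least its positive constant term. *)
  move=> xR hx; split=> //; rewrite real_ltNge //; apply/negP => x0.
  have := nneg_horner_gt0 _ _ _ (pN k.+1) (p_gt0 k.+1) x0.
  by rewrite (rootP px) ltxx.
split=> [x /p_root[]//|x]; rewrite rootM.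
(* Cayley-Hamilton for the transfer matrix, evaluated at x. *)
have recE : (p k.+2).[x] = (a + d).[x] * (p k.+1).[x] - (a * d - b * c).[x] * (p k).[x].
  rewrite pS qS pS !(hornerD, hornerN, hornerM); ring.
case/orP => [bx|px].
  have [x0 ax b'x p0x] := b_root x bx; split=> //.
  (* A common root of b and p_{k+1} would annihilate F in G' F > 0. *)
  have px : (p k.+1).[x] != 0.
    apply/negP => /p_root[_]; by rewrite hornerM (rootP bx) mul0r mulr0 ltxx.
  have -> : (p k.+2).[x] * (b * p k.+1)^`().[x] = a.[x] * (b^`().[x] * (p k.+1).[x] ^+ 2).
    rewrite [p k.+2]pS derivM !hornerD !hornerM (rootP bx); ring.
  by rewrite nmulr_rlt0 // mulr_gt0 // sqr_gt0.
have [x0 hx] := p_root x px; split=> //.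
have -> : (p k.+2).[x] * (b * p k.+1)^`().[x] =
    - ((a * d - b * c).[x] * ((p k.+1)^`().[x] * (b * p k).[x])).
  rewrite recE derivM;
  move: (a * d - b * c).[x] (a + d).[x] => D T.
  rewrite hornerD !hornerM (rootP px); ring.
by rewrite oppr_lt0 mulr_gt0 // D_gt0.
Qed.

(** * Nonnegative entries and degree bounds *)

Lemma nneg_polyD (C : numDomainType) (p q : {poly C}) :
  p \is a polyOver Num.nneg -> q \is a polyOver Num.nneg ->
  p + q \is a polyOver Num.nneg.
Proof. exact: (polyOver_addr_closed _).2. Qed.

Lemma nneg_polyM (C : numDomainType) (p q : {poly C}) :
  p \is a polyOver Num.nneg -> q \is a polyOver Num.nneg ->
  p * q \is a polyOver Num.nneg.
Proof. exact: polyOver_mulr_2closed. Qed.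

Lemma nneg_poly_nat (C : numDomainType) (n : nat) :
  (n%:R : {poly C}) \is a polyOver Num.nneg.
Proof. by rewrite -polyC_natr polyOverC nnegrE ler0n. Qed.

Lemma nneg_polyX (C : numDomainType) : ('X : {poly C}) \is a polyOver Num.nneg.
Proof. by apply/polyOverP => i; rewrite coefX nnegrE ler0n. Qed.

Lemma horner_nat (C : nzRingType) (n : nat) (x : C) : (n%:R : {poly C}).[x] = n%:R.
Proof. by rewrite -polyC_natr hornerC. Qed.

Lemma leq_pred_addS (x y z : nat) :
  (x <= y.+1 -> 0 < y -> (x + z).-1 <= (y + z).-1.+1)%N.
Proof. by lia. Qed.

Lemma leq_pred_add (x y z : nat) : (x <= y.+1 -> (x + z).-1 <= y + z)%N.
Proof. by lia. Qed.

(** Conditions for all k are reduced to conditions on the entries and the initial vector. As the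
    determinant vanishes at 0, the recurrence there is p_{k+2}(0) = tr M(0) p_{k+1}(0), which keeps
    constant terms positive. The bound deg q_k <= deg p_k + 1 persists because nothing cancels, and
    it controls the degree of p_{k+1}. *)
Lemma nneg_transfer_roots_lt0 (C : numClosedFieldType) (a b c d : {poly C})
    (p q : nat -> {poly C}) :
    (forall k, p k.+1 = a * p k + b * q k) ->
    (forall k, q k.+1 = c * p k + d * q k) ->
    [/\ a \is a polyOver Num.nneg, b \is a polyOver Num.nneg,
        c \is a polyOver Num.nneg & d \is a polyOver Num.nneg] ->
    p 0 \is a polyOver Num.nneg -> q 0 \is a polyOver Num.nneg ->
    [/\ (0 < size a <= (size b).+1)%N, (0 < size b)%N,
        (size c <= (size a).+1)%N & (size d <= (size b).+1)%N] ->
    (size (q 0) <= (size (p 0)).+1)%N ->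
    [/\ (a * d - b * c).[0] = 0, 0 < (a + d).[0],
        0 < (p 0).[0] & 0 < (a * p 0 + b * q 0).[0]] ->
    (forall x, x < 0 -> 0 < (a * d - b * c).[x]) ->
    (forall x, root b x ->
       [/\ x < 0, a.[x] < 0, 0 < b^`().[x] & (p 0).[x] != 0]) ->
    (forall x, root (p 0) x -> x < 0 /\ (p 0)^`().[x] * (q 0).[x] < 0) ->
  forall k x, root (p k) x -> x < 0.
Proof.
move=> pS qS [aN bN cN dN] p0N q0N [/andP[a_gt0 sa] b_gt0 sc sd] sq0.
move=> [D0 T0 p0_gt0 p1_gt0] D_gt0 b_root p0_root.
have pqN k : p k \is a polyOver Num.nneg /\ q k \is a polyOver Num.nneg.
  elim: k => [//|k [pN qN]]; rewrite pS qS.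
  by split; apply: nneg_polyD; apply: nneg_polyM.
have p_gt0 k : 0 < (p k).[0] /\ 0 < (p k.+1).[0].
  elim: k => [|k [IH IH1]]; first by rewrite pS.
  split=> //.
  have -> : (p k.+2).[0] = (a + d).[0] * (p k.+1).[0] - (a * d - b * c).[0] * (p k).[0].
    rewrite pS qS pS !(hornerD, hornerN, hornerM); ring.
  by rewrite D0 mul0r subr0 mulr_gt0.
have b0 : b != 0 by rewrite -size_poly_gt0.
have a0 : a != 0 by rewrite -size_poly_gt0.
have pN0 k : p k != 0.
  by apply: contraTneq (p_gt0 k).1 => ->; rewrite horner0 ltxx.
have sq k : (size (q k) <= (size (p k)).+1)%N.
  elim: k => [//|k IH]; have [pN qN] := pqN k.
  rewrite qS pS (leq_trans (size_polyD _ _)) // geq_max; apply/andP; split.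
    rewrite (leq_trans (size_polyMleq _ _)) //.
    rewrite (@leq_trans (size (a * p k)%R).+1) //.
      by rewrite size_mul // leq_pred_addS.
    by rewrite ltnS size_nneg_addl // nneg_polyM.
  have [->|qk0] := eqVneq (q k) 0; first by rewrite mulr0 size_poly0.
  rewrite (leq_trans (size_polyMleq _ _)) //.
  rewrite (@leq_trans (size (b * q k)%R).+1) //.
    by rewrite size_mul // leq_pred_addS.
  by rewrite ltnS addrC size_nneg_addl // nneg_polyM.
apply: (transfer_roots_lt0 _ a b c d p q) => // k.
- by have [] := pqN k.
- by have [] := p_gt0 k.
rewrite pS (leq_trans (size_polyD _ _)) // geq_max; apply/andP; split.
  exact: leq_trans (size_polyMleq _ _) (leq_pred_add _ _ _ sa).
by rewrite addnC; apply: leq_trans (size_polyMleq _ _) _; rewrite addnC leq_pred_add.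
Qed.

(** * Reduction to arithmetic of natural numbers *)

Lemma entry_expSr (A : comNzRingType) (M : 'M[A]_2) (v : 'cV[A]_2) (k : nat) (i : 'I_2) :
  (M ^+ k.+1 *m v) i 0 = M i 0 * (M ^+ k *m v) 0 0 + M i 1 * (M ^+ k *m v) 1 0.
Proof.
have ord1E : lift ord0 ord0 = 1 :> 'I_2 by apply: val_inj.
by rewrite exprS -mulmxA mxE big_ord_recl big_ord1 ord1E.
Qed.

(** A common shape for all matrix and vector entries, so that sign and degree conditions become
    inequalities between natural numbers. *)
Definition nat_quadratic (A : nzRingType) (l m n : nat) : {poly A} :=
  l%:R + m%:R * 'X + n%:R * 'X^2.

Lemma nneg_nat_quadratic (C : numDomainType) (l m n : nat) :
  nat_quadratic C l m n \is a polyOver Num.nneg.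
Proof.
rewrite /nat_quadratic expr2.
by do ?[exact: nneg_poly_nat | exact: nneg_polyX | apply: nneg_polyM | apply: nneg_polyD].
Qed.

Lemma horner_nat_quadratic (A : comNzRingType) (l m n : nat) (x : A) :
  (nat_quadratic A l m n).[x] = l%:R + m%:R * x + n%:R * x ^+ 2.
Proof. by rewrite !(hornerD, hornerM, horner_nat, hornerX, hornerXn). Qed.

Lemma deriv_nat_quadratic (A : comNzRingType) (l m n : nat) :
  (nat_quadratic A l m n)^`() = nat_quadratic A m n.*2 0.
Proof.
rewrite /nat_quadratic -!polyC_natr !(derivD, derivM, derivC, derivX, derivXn).
rewrite !polyC_natr expr1 -muln2 natrM; ring.
Qed.

Lemma size_nat_quadratic (C : numDomainType) (l m n : nat) :
  size (nat_quadratic C l m n) =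
  (if n != 0 then 3 else if m != 0 then 2 else l != 0 : nat)%N.
Proof.
have -> : nat_quadratic C l m n = (n%:R%:P * 'X + m%:R%:P) * 'X + l%:R%:P.
  by rewrite /nat_quadratic !polyC_natr; ring.
rewrite size_MXaddC -size_poly_eq0 size_MXaddC polyC_eq0 !pnatr_eq0 size_polyC pnatr_eq0.
by case: n m l => [|n] [|m] [|l].
Qed.

Lemma map_nat_quadratic (C : nzRingType) (l m n : nat) :
  map_poly intr (nat_quadratic int l m n) = nat_quadratic C l m n.
Proof.
by rewrite !(rmorphD, rmorphM, rmorphXn) !rmorph_nat /= map_polyX.
Qed.

(** With y the inverse of n, the root is -(m y), and inserting factors n y = 1 makes any polynomial
    in the root homogeneous in y, which clears denominators. *)
Lemma linear_root_nat (C : numFieldType) (m n : nat) (x : C) :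
    (0 < m)%N -> m%:R + n%:R * x = 0 ->
  exists2 y : C, 0 < y & [/\ x = - (m%:R * y), n%:R * y = 1 & (0 < n)%N].
Proof.
move=> m_gt0 mnx; have n_gt0 : (0 < n)%N.
  case: n mnx => // /eqP; rewrite mul0r addr0 pnatr_eq0 => /eqP m0.
  by rewrite m0 in m_gt0.
have n0 : n%:R != 0 :> C by rewrite pnatr_eq0 -lt0n.
exists n%:R^-1; first by rewrite invr_gt0 ltr0n.
split=> //; last exact: mulfV.
apply: (mulfI n0); apply/eqP; rewrite -subr_eq0 -mnx; apply/eqP; field.
exact: n0.
Qed.

(* The last three conditions are, after clearing denominators: det M (- y) has
   nonnegative coefficients, not all zero; a < 0 and p 0 <> 0 at the root of b;
   q 0 < 0 at the root of p 0. *)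
Lemma nat_transfer_roots_lt0 (C : numClosedFieldType)
    (a0 a1 b0 b1 c1 c2 d0 d1 p0 p1 q0 q1 q2 : nat) (p q : nat -> {poly C}) :
    let E := nat_quadratic C in
    (forall k, p k.+1 = E a0 a1 0 * p k + E b0 b1 0 * q k) ->
    (forall k, q k.+1 = E 0 c1 c2 * p k + E d0 d1 0 * q k) ->
    p 0 = E p0 p1 0 -> q 0 = E q0 q1 q2 ->
    [&& 0 < a0 + a1, 0 < b0, 0 < p0, a0 * d0 == 0, 0 < a0 + d0
      & 0 < a0 * p0 + b0 * q0]%N ->
    (0 < c2 -> 0 < a1)%N -> (0 < q2 -> 0 < p1)%N ->
    [&& a0 * d1 + a1 * d0 <= b0 * c1, b0 * c2 + b1 * c1 <= a1 * d1
      & a0 * d1 + a1 * d0 + (b0 * c2 + b1 * c1) <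
        b0 * c1 + a1 * d1 + b1 * c2]%N ->
    (0 < b1 -> a0 * b1 < a1 * b0 /\ p0 * b1 <> p1 * b0)%N ->
    (0 < p1 -> q0 * (p1 * p1) + q2 * (p0 * p0) < q1 * (p0 * p1))%N ->
  forall k x, root (p k) x -> x < 0.
Proof.
move=> E pS qS pE qE /and5P[a_gt0 b_gt0 p_gt0 ad0 /andP[T_gt0 p1_gt0]] sc sq.
move=> /and3P[D1 D2 D12] b_root p_root.
have EN l m n : E l m n \is a polyOver Num.nneg by apply: nneg_nat_quadratic.
have Ex l m n x : (E l m n).[x] = l%:R + m%:R * x + n%:R * x ^+ 2.
  exact: horner_nat_quadratic.
have E0 l m n : (E l m n).[0] = l%:R by rewrite Ex expr0n !mulr0 !addr0.
(* The determinant in powers of -x, its constant term a0 d0 being zero. The truncated subtractions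
   are exact by [D1] and [D2]. *)
have D_E x : (E a0 a1 0 * E d0 d1 0 - E b0 b1 0 * E 0 c1 c2).[x] =
    (b0 * c1 - (a0 * d1 + a1 * d0))%N%:R * - x +
    (a1 * d1 - (b0 * c2 + b1 * c1))%N%:R * x ^+ 2 + (b1 * c2)%N%:R * (- x) ^+ 3.
  rewrite hornerD hornerN !hornerM !Ex !natrB // !(natrD, natrM).
  have : a0%:R * d0%:R = 0 :> C by rewrite -natrM (eqP ad0).
  move=> ad0R; rewrite !(mul0r, addr0, add0r) mulrDl !mulrDr ad0R; ring.
have realx (x : C) : x < 0 -> 0 < - x by rewrite oppr_gt0.
apply: (nneg_transfer_roots_lt0 C _ _ _ _ p q pS qS).
- by split; apply: EN.
- by rewrite pE.
- by rewrite qE.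
(* As a and b are nonzero and a, b, d have degree at most one, the only critical case is a quadratic
   c with a constant a, excluded by [sc]. *)
- rewrite !size_nat_quadratic /=.
  by split; move: a_gt0 b_gt0 sc;
    case: a0 a1 b0 b1 c1 c2 d0 d1
      {pS qS D_E ad0 T_gt0 p1_gt0 D1 D2 D12 b_root}
    => [|?] [|?] [|?] [|?] [|?] [|?] [|?] [|?] //= _ _ h; exact: h isT.
- rewrite pE qE !size_nat_quadratic.
  move: p_gt0 sq; case: p0 p1 q0 q1 q2 {pE qE p1_gt0 b_root p_root}
    => [|?] [|?] [|?] [|?] [|?] //= _ h; exact: h isT.
- split.
  + by rewrite D_E; ring.
  + by rewrite hornerD !E0 -natrD ltr0n.
  + by rewrite pE E0 ltr0n.
  + by rewrite hornerD !hornerM pE qE !E0 -!natrM -natrD ltr0n.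
- move=> x x0; rewrite D_E -sqrrN; have := realx x x0; move: (- x) => y y0.
  (* By [D12] the three coefficients have a positive sum, so one of them is positive. *)
  have : ((0 < b0 * c1 - (a0 * d1 + a1 * d0)) ||
          (0 < a1 * d1 - (b0 * c2 + b1 * c1)) || (0 < b1 * c2))%N by lia.
  have ge0 (n : nat) (t : C) : 0 < t -> 0 <= n%:R * t
    by move=> t0; rewrite mulr_ge0 ?ler0n ?ltW.
  have gt0 (n : nat) (t : C) : 0 < t -> (0 < n)%N -> 0 < n%:R * t
    by move=> t0 n0; rewrite mulr_gt0 ?ltr0n.
  case/orP=> [/orP[]|] h.
  + by rewrite ltr_wpDr ?ltr_wpDr ?ge0 ?gt0 ?exprn_gt0.
  + by rewrite ltr_wpDr ?ltr_wpDl ?ge0 ?gt0 ?exprn_gt0.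
  + by rewrite ltr_wpDl ?addr_ge0 ?ge0 ?gt0 ?exprn_gt0.
- move=> x /rootP; rewrite Ex mul0r addr0 => bx.
  have [y y0 [xE b1y b1_gt0]] := linear_root_nat _ _ _ _ b_gt0 bx.
  have yE t : t = t * (b1%:R * y) by rewrite b1y mulr1.
  have [ab pb] := b_root b1_gt0.
  have x0 : x < 0 by rewrite xE oppr_lt0 mulr_gt0 ?ltr0n.
  split=> //.
  + rewrite Ex mul0r addr0 xE {1}(yE a0%:R).
    have -> : a0%:R * (b1%:R * y) + a1%:R * - (b0%:R * y) = - ((a1 * b0 - a0 * b1)%N%:R * y).
      rewrite natrB; last exact: ltnW.
      rewrite !natrM; ring.
    by rewrite oppr_lt0 mulr_gt0 // ltr0n subn_gt0.
  + by rewrite deriv_nat_quadratic horner_nat_quadratic !mul0r !addr0 ltr0n.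
  + rewrite pE Ex mul0r addr0 xE {1}(yE p0%:R).
    have -> : p0%:R * (b1%:R * y) + p1%:R * - (b0%:R * y) = ((p0 * b1)%N%:R - (p1 * b0)%N%:R) * y.
      rewrite !natrM; ring.
    by rewrite mulf_neq0 ?(gt_eqF y0) // subr_eq0 eqr_nat; apply/eqP.
- move=> x /rootP; rewrite pE qE Ex mul0r addr0 => px.
  have [y y0 [xE p1y p1_gt]] := linear_root_nat _ _ _ _ p_gt0 px.
  have yE t : t = t * (p1%:R * y) by rewrite p1y mulr1.
  have x0 : x < 0 by rewrite xE oppr_lt0 mulr_gt0 ?ltr0n.
  split=> //.
  rewrite deriv_nat_quadratic horner_nat_quadratic !mul0r !addr0.
  rewrite pmulr_rlt0 ?ltr0n // Ex xE {1}(yE q0%:R).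
  have -> : q0%:R * (p1%:R * y) + q1%:R * - (p0%:R * y) + q2%:R * (- (p0%:R * y)) ^+ 2 =
    - ((q1 * (p0 * p1) - (q0 * (p1 * p1) + q2 * (p0 * p0)))%N%:R * y ^+ 2).
    rewrite natrB; last by rewrite ltnW // p_root.
    rewrite !(natrD, natrM).
    (* The constant term receives its second factor p1 y and the linear term its first, so all terms
       have degree two in y. *)
    rewrite {1}(yE q0%:R).
    rewrite [q1%:R * - _]yE.
    ring.
  by rewrite oppr_lt0 mulr_gt0 ?exprn_gt0 // ltr0n subn_gt0 p_root.
Qed.

Lemma int_transfer_roots_lt0 (C : numClosedFieldType)
    (a0 a1 b0 b1 c1 c2 d0 d1 p0 p1 q0 q1 q2 : nat)
    (M : 'M[{poly int}]_2) (v : 'cV[{poly int}]_2) :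
    let E := nat_quadratic int in
    [/\ M 0 0 = E a0 a1 0%N, M 0 1 = E b0 b1 0%N, M 1 0 = E 0%N c1 c2
      & M 1 1 = E d0 d1 0%N] ->
    v 0 0 = E p0 p1 0%N -> v 1 0 = E q0 q1 q2 ->
    [&& 0 < a0 + a1, 0 < b0, 0 < p0, a0 * d0 == 0, 0 < a0 + d0
      & 0 < a0 * p0 + b0 * q0]%N ->
    (0 < c2 -> 0 < a1)%N -> (0 < q2 -> 0 < p1)%N ->
    [&& a0 * d1 + a1 * d0 <= b0 * c1, b0 * c2 + b1 * c1 <= a1 * d1
      & a0 * d1 + a1 * d0 + (b0 * c2 + b1 * c1) <
        b0 * c1 + a1 * d1 + b1 * c2]%N ->
    (0 < b1 -> a0 * b1 < a1 * b0 /\ p0 * b1 <> p1 * b0)%N ->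
    (0 < p1 -> q0 * (p1 * p1) + q2 * (p0 * p0) < q1 * (p0 * p1))%N ->
  forall k (z : C), root (map_poly intr ((M ^+ k *m v) 0 0)) z -> z < 0.
Proof.
move=> E [Ma Mb Mc Md] vp vq.
pose p k : {poly C} := map_poly intr ((M ^+ k *m v) 0 0).
pose q k : {poly C} := map_poly intr ((M ^+ k *m v) 1 0).
apply: (nat_transfer_roots_lt0 C _ _ _ _ _ _ _ _ _ _ _ _ _ p q) => [k|k||].
- by rewrite /p entry_expSr rmorphD !rmorphM Ma Mb /= !map_nat_quadratic.
- by rewrite /q entry_expSr rmorphD !rmorphM Mc Md /= !map_nat_quadratic.
- by rewrite /p expr0 mul1mx vp map_nat_quadratic.
- by rewrite /q expr0 mul1mx vq map_nat_quadratic.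
Qed.

(** * The six linear families *)

(** In a [numClosedFieldType], z < 0 already says that z is real, so this one inequality carries
    both claims. *)
Lemma stahl_roots_lt0 (C : numClosedFieldType) (i k : nat) (z : C) :
    (1 <= i <= 6)%N -> root (map_poly intr (stahl_poly i k)) z -> z < 0.
Proof.
case: i => [|[|[|[|[|[|[|//]]]]]]] // _; rewrite /stahl_poly.
(* The numbers are the coefficients of a, b, c, d and of the two vector entries, lowest degree
   first; those of c start at degree one. *)
- apply: (int_transfer_roots_lt0 C 4 0 2 0 6 0 0 0 1 0 0 1 0);
    rewrite ?mxE /nat_quadratic /=; try lia; try ring.
  by split; rewrite ?mxE /=; ring.
- (* In the basis (p, 2q - p) the matrix is (2 2; 4x 0): with a = 0, as in M_2
     itself, the degree condition on the entry c would fail. *)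
  pose M := stahl_mx 2; pose v := stahl_vec 2.
  pose p k : {poly C} := map_poly intr ((M ^+ k *m v) 0 0).
  pose q2 k : {poly C} := map_poly intr ((M ^+ k *m v) 1 0).
  pose q n := 2 * q2 n - p n.
  have qE n : q n = 2 * q2 n - p n by [].
  have vE j : v j 0 = nat_quadratic int 1 0 0.
    by rewrite !mxE /nat_quadratic; case: eqP => _; ring.
  have [Ma Mb Mc Md] : [/\ M 0 0 = nat_quadratic int 0 0 0,
      M 0 1 = nat_quadratic int 4 0 0, M 1 0 = nat_quadratic int 0 2 0 & M 1 1 = nat_quadratic int 2 0 0].
    by split; rewrite !mxE /nat_quadratic /=; ring.
  have pS n : p n.+1 = 4 * q2 n.
    rewrite /p entry_expSr Ma Mb rmorphD !rmorphM /= !map_nat_quadratic -/(p n) -/(q2 n).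
    rewrite /nat_quadratic; ring.
  have q2S n : q2 n.+1 = 2 * 'X * p n + 2 * q2 n.
    rewrite /q2 entry_expSr Mc Md rmorphD !rmorphM /= !map_nat_quadratic -/(p n) -/(q2 n).
    rewrite /nat_quadratic; ring.
  clearbody q.
  apply: (nat_transfer_roots_lt0 C 2 0 2 0 4 0 0 0 1 0 1 0 0 p q) => [n|n||||||||] //.
  + rewrite pS qE /nat_quadratic; ring.
  + rewrite qE pS q2S /nat_quadratic; ring.
  + by rewrite /p expr0 mul1mx vE map_nat_quadratic.
  + rewrite qE /p /q2 expr0 mul1mx !vE map_nat_quadratic /nat_quadratic; ring.
(* The scalar factors 6 and 2 are multiplied into the entries; likewise 4 and 2 for diamonds. *)
- apply: (int_transfer_roots_lt0 C 0 18 18 0 12 0 6 18 4 0 2 2 0);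
    rewrite ?mxE /nat_quadratic /=; try lia; try ring.
  by split; rewrite ?mxE /=; ring.
- apply: (int_transfer_roots_lt0 C 8 12 4 0 16 0 0 8 2 2 0 4 0);
    rewrite ?mxE /nat_quadratic /=; try lia; try ring.
  by split; rewrite ?mxE /=; ring.
- apply: (int_transfer_roots_lt0 C 0 192 96 288 72 192 24 288 18 18 6 30 0);
    rewrite ?mxE /nat_quadratic /=; try lia; try ring.
  by split; rewrite ?mxE /=; ring.
- apply: (int_transfer_roots_lt0 C 8 68 4 16 32 48 0 16 2 14 0 8 8);
    rewrite ?mxE /nat_quadratic /=; try lia; try ring.
  by split; rewrite ?mxE /=; ring.
Qed.

Local Open Scope complex_scope.

Theorem proposition3p11 (R : realType) (i k : nat)
    (hi : (1 <= i <= 6)%N) (hk : (1 <= k)%N) (z : R[i])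
    (hz : root (map_poly intr (stahl_poly i k)) z) :
  exists2 x : R, x < 0 & z = x%:C.
Proof.
have := stahl_roots_lt0 _ i k z hi hz.
(* The order on [R[i]] compares only numbers with equal imaginary parts. *)
by case: z {hz} => x y; rewrite ltcE /= => /andP[/eqP <- x0]; exists x.
Qed.
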